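(* There exist no proper rotating solutions to free boundary curve shortening flow in the unit disc $B^2\subset\mathbb{R}^2\cong\mathbb{C}$. That is, there do not exist $B>0$, $L>0$ and a smooth arc-length parametrized curve $\gamma_0:[-\tfrac L2,\tfrac L2]\to\overline{B}{}^2$ which maps $(-\tfrac L2,\tfrac L2)$ into $B^2$ and the endpoints $\pm\tfrac L2$ into $\partial B^2$, which meets $\partial B^2$ orthogonally at its endpoints, and for which the family of curves $\{\mathrm{e}^{iBt}\gamma_0\}_{t\in(-\infty,\infty)}$ is a solution to free boundary curve shortening flow.
   Context: $B^2$ is the open unit disc in $\mathbb{R}^2\cong\mathbb{C}$, and $\mathrm{e}^{iBt}$ acts by rotation about the origin through the angle $Bt$. A solution to free boundary curve shortening flow in $B^2$ is a smooth one-parameter family of regular (immersed) curves with interior in $B^2$ and endpoints on the circle $\partial B^2$, meeting $\partial B^2$ orthogonally at the endpoints, such that the normal component of the velocity at each point equals the curvature vector of the curve. A rotating solution is a solution which (as a family of curves, up to tangential reparametrization) is of the form $\gamma(\cdot,t)=\mathrm{e}^{iBt}\gamma(\cdot,0)$ for some $B>0$. *)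

(* Defs.v *)
(* Based on the Stdlib reals and Coquelicot; the plane R^2 is Coquelicot's C. *)
From Stdlib Require Import Reals.
From Coquelicot Require Import Coquelicot.
Open Scope R_scope.

(* The Euclidean inner product of R^2. *)
Definition inner (u v : C) : R := Re (u * Cconj v)%C.

Definition cis (theta : R) : C := (cos theta, sin theta).

(* Derivative relative to the closed interval [a, b]: one-sided at a and b, and
   independent of the values of f outside [a, b]. *)
Definition is_derivative_on (a b : R) (f f' : R -> C) : Prop :=
  forall s : R, a <= s <= b ->
    filterdiff (K := R_AbsRing) (U := R_NormedModule) (V := C_R_NormedModule)
      f (within (fun x : R => a <= x <= b) (locally s))
      (fun h : R => scal h (f' s : C_R_NormedModule)).

(* C^oo on [a, b] up to the endpoints; D n is the n-th derivative. *)
Definition smooth_curve (a b : R) (gamma : R -> C) : Prop :=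
  exists D : nat -> R -> C,
    D O = gamma /\ forall n : nat, is_derivative_on a b (D n) (D (S n)).

(* C^oo on R x [a, b] up to the boundary, for a family F t s with time t and
   curve parameter s; D i j is the derivative of order i in s and j in t. *)
Definition smooth_family (a b : R) (F : R -> R -> C) : Prop :=
  exists D : nat -> nat -> R -> R -> C,
    D O O = F /\
    forall (i j : nat) (t : R),
      is_derivative_on a b (D i j t) (D (S i) j t) /\
      forall s : R, a <= s <= b ->
        is_derive (K := R_AbsRing) (V := C_R_NormedModule)
          (fun t' : R => D i j t' s) t (D i (S j) t s) /\
        filterlim (fun p : R * R => D i j (fst p) (snd p))
          (within (fun p : R * R => a <= snd p <= b) (locally (t, s)))
          (locally (D i j t s)).

Definition unit_speed (a b : R) (gamma : R -> C) : Prop :=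
  exists gamma' : R -> C,
    is_derivative_on a b gamma gamma' /\
    forall s : R, a <= s <= b -> Cmod (gamma' s) = 1.

Definition proper_in_disc (a b : R) (gamma : R -> C) : Prop :=
  (forall s : R, a < s < b -> Cmod (gamma s) < 1) /\
  Cmod (gamma a) = 1 /\ Cmod (gamma b) = 1.

(* The tangent line of the unit circle at z is spanned by i z. *)
Definition meets_circle_orthogonally (a b : R) (gamma : R -> C) : Prop :=
  exists gamma' : R -> C,
    is_derivative_on a b gamma gamma' /\
    inner (gamma' a) (Ci * gamma a)%C = 0 /\
    inner (gamma' b) (Ci * gamma b)%C = 0.

Definition unit_tangent (gamma' : R -> C) (s : R) : C :=
  (gamma' s / RtoC (Cmod (gamma' s)))%C.

(* k is the derivative of the unit tangent with respect to arc length, for a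
   curve with velocity gamma' in an arbitrary regular parametrization. *)
Definition is_curvature_vector (a b : R) (gamma' k : R -> C) : Prop :=
  exists T' : R -> C,
    is_derivative_on a b (unit_tangent gamma') T' /\
    forall s : R, a <= s <= b -> k s = (T' s / RtoC (Cmod (gamma' s)))%C.

(* The component of v orthogonal to the unit vector T. *)
Definition normal_component (T v : C) : C := (v - RtoC (inner v T) * T)%C.

(* Solutions defined for all times t in (-oo, +oo). Only the normal component
   of the velocity is prescribed, so the notion is invariant under
   time-dependent reparametrization of the curves F t. *)
Definition free_boundary_csf (a b : R) (F : R -> R -> C) : Prop :=
  smooth_family a b F /\
  (forall t : R, proper_in_disc a b (F t)) /\
  (forall t : R, meets_circle_orthogonally a b (F t)) /\
  forall t : R,
    exists Fs Ft k : R -> C,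
      is_derivative_on a b (F t) Fs /\
      (forall s : R, a <= s <= b -> Fs s <> RtoC 0) /\
      (forall s : R, a <= s <= b ->
         is_derive (K := R_AbsRing) (V := C_R_NormedModule)
           (fun t' : R => F t' s) t (Ft s)) /\
      is_curvature_vector a b Fs k /\
      forall s : R, a <= s <= b ->
        normal_component (unit_tangent Fs s) (Ft s) = k s.

(* Main.v *)
(* Write [T] for the unit tangent, [N = i T], [kappa] for the curvature.  For a
   curve rotating with angular speed [B] the flow equation reads
   [kappa = B <gamma, T>], so the support function [g = <gamma, N>] satisfies
   [g' = - kappa <gamma, T> = - B <gamma, T>^2 <= 0].  The free boundary
   condition says that [g] vanishes at both endpoints, so [g] is constant; but
   at an endpoint [|gamma| = 1] and [g = 0] force [<gamma, T>^2 = 1], hence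
   [g' = - B < 0] there. *)

Require Import Defs.
From Stdlib Require Import Reals Lra.
From Coquelicot Require Import Coquelicot.
Open Scope R_scope.

(** * Differential calculus on a closed interval *)

Definition is_real_derivative_on (a b : R) (f f' : R -> R) : Prop :=
  forall s : R, a <= s <= b -> forall eps : posreal, exists delta : posreal,
    forall x : R, a <= x <= b -> Rabs (x - s) < delta ->
      Rabs (f x - f s - (x - s) * f' s) <= eps * Rabs (x - s).

(** Unfolds the filter formulation into an epsilon-delta estimate, so that later proofs can choose
    nearby points of the interval explicitly. *)
Lemma filterdiff_within_scal (D : R -> Prop) (f : R -> R) (s l : R) :
  filterdiff (K := R_AbsRing) (U := R_NormedModule) (V := R_NormedModule)
    f (within D (locally s)) (fun h : R => scal h l) ->
  forall eps : posreal, exists delta : posreal,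
    forall x : R, D x -> Rabs (x - s) < delta ->
      Rabs (f x - f s - (x - s) * l) <= eps * Rabs (x - s).
Proof.
intros [_ Hd] eps.
assert (Hlim : is_filter_lim (within D (locally s)) s).
{ intros P HP. now apply filter_le_within. }
destruct (Hd s Hlim eps) as [delta Hdelta].
exists delta; intros x Dx Hx.
exact (Hdelta x Hx Dx).
Qed.

Lemma is_derivative_on_Re (a b : R) (f f' : R -> C) :
  is_derivative_on a b f f' ->
  is_real_derivative_on a b (fun s => Re (f s)) (fun s => Re (f' s)).
Proof.
intros Hf s Hs.
apply (filterdiff_within_scal (fun x => a <= x <= b)).
exact (filterdiff_comp f (fst : C_R_NormedModule -> R_NormedModule) _ _
  (Hf s Hs) (filterdiff_linear _ is_linear_fst)).
Qed.

Lemma is_derivative_on_Im (a b : R) (f f' : R -> C) :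
  is_derivative_on a b f f' ->
  is_real_derivative_on a b (fun s => Im (f s)) (fun s => Im (f' s)).
Proof.
intros Hf s Hs.
apply (filterdiff_within_scal (fun x => a <= x <= b)).
exact (filterdiff_comp f (snd : C_R_NormedModule -> R_NormedModule) _ _
  (Hf s Hs) (filterdiff_linear _ is_linear_snd)).
Qed.

Lemma is_real_derivative_on_ext (a b : R) (f g f' g' : R -> R) :
  (forall s, a <= s <= b -> f s = g s) ->
  (forall s, a <= s <= b -> f' s = g' s) ->
  is_real_derivative_on a b f f' -> is_real_derivative_on a b g g'.
Proof.
intros Efg Efg' Hf s Hs eps.
destruct (Hf s Hs eps) as [delta Hdelta].
exists delta; intros x Hx Hxs.
rewrite <- (Efg x Hx), <- (Efg s Hs), <- (Efg' s Hs).
now apply Hdelta.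
Qed.

Lemma is_real_derivative_on_unique (a b : R) (f f1 f2 : R -> R) :
  a < b ->
  is_real_derivative_on a b f f1 -> is_real_derivative_on a b f f2 ->
  forall s, a <= s <= b -> f1 s = f2 s.
Proof.
intros Hab H1 H2 s Hs.
destruct (Req_dec (f1 s) (f2 s)) as [E | NE]; [exact E | exfalso].
assert (Hpos : 0 < Rabs (f1 s - f2 s)) by (apply Rabs_pos_lt; lra).
(* With a quarter of the gap as tolerance, the two approximation errors add up to at most half of
   the gap. *)
assert (Heps : 0 < Rabs (f1 s - f2 s) / 4) by lra.
destruct (H1 s Hs (mkposreal _ Heps)) as [d1 Hd1].
destruct (H2 s Hs (mkposreal _ Heps)) as [d2 Hd2].
simpl in Hd1, Hd2.
assert (Hx : exists x, a <= x <= b /\ x <> s /\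
               Rabs (x - s) < d1 /\ Rabs (x - s) < d2).
{ pose proof (cond_pos d1); pose proof (cond_pos d2).
  set (m := Rmin (Rmin d1 d2) (b - a) / 2).
  assert (Hm : 0 < m /\ m < d1 /\ m < d2 /\ m <= (b - a) / 2).
  { assert (0 < Rmin (Rmin d1 d2) (b - a)) by (repeat apply Rmin_glb_lt; lra).
    pose proof (Rmin_l (Rmin d1 d2) (b - a)).
    pose proof (Rmin_r (Rmin d1 d2) (b - a)).
    pose proof (Rmin_l d1 d2); pose proof (Rmin_r d1 d2).
    unfold m; lra. }
  (* Moving towards the farther endpoint stays inside, since [m] is at most half the length of the
     interval. *)
  destruct (Rle_dec s ((a + b) / 2)) as [Hl | Hr].
  - exists (s + m); replace (s + m - s) with m by ring.
    rewrite Rabs_pos_eq; lra.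
  - exists (s - m); replace (s - m - s) with (- m) by ring.
    rewrite Rabs_Ropp, Rabs_pos_eq; lra. }
destruct Hx as (x & Hx & Hne & Hx1 & Hx2).
specialize (Hd1 x Hx Hx1); specialize (Hd2 x Hx Hx2).
assert (Hxs : 0 < Rabs (x - s)) by (apply Rabs_pos_lt; lra).
assert (Hmul : Rabs (x - s) * Rabs (f1 s - f2 s) <=
               Rabs (x - s) * (Rabs (f1 s - f2 s) / 2)).
{ rewrite <- Rabs_mult at 1.
  replace ((x - s) * (f1 s - f2 s)) with
    ((f x - f s - (x - s) * f2 s) - (f x - f s - (x - s) * f1 s)) by ring.
  eapply Rle_trans; [apply Rabs_triang |].
  rewrite Rabs_Ropp; lra. }
apply Rmult_le_reg_l in Hmul; lra.
Qed.

(** The definitions of unit speed, orthogonality and the flow each supply their own derivative of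
    the curve; this identifies them on the interval. *)
Lemma is_derivative_on_unique (a b : R) (f f1 f2 : R -> C) :
  a < b -> is_derivative_on a b f f1 -> is_derivative_on a b f f2 ->
  forall s, a <= s <= b -> f1 s = f2 s.
Proof.
intros Hab H1 H2 s Hs.
pose proof (is_real_derivative_on_unique _ _ _ _ _ Hab
  (is_derivative_on_Re _ _ _ _ H1) (is_derivative_on_Re _ _ _ _ H2) s Hs) as E1.
pose proof (is_real_derivative_on_unique _ _ _ _ _ Hab
  (is_derivative_on_Im _ _ _ _ H1) (is_derivative_on_Im _ _ _ _ H2) s Hs) as E2.
apply injective_projections; assumption.
Qed.

(* Continuing [f] affinely beyond the endpoints turns one-sided derivatives
   into two-sided ones. *)
Lemma is_real_derivative_on_extend (a b : R) (f f' : R -> R) :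
  a < b -> is_real_derivative_on a b f f' ->
  exists h : R -> R, forall s, a <= s <= b ->
    h s = f s /\ is_derive h s (f' s).
Proof.
intros Hab Hf.
(* [c] is the nearest-point projection onto [[a, b]]. *)
set (c := fun x => Rmax a (Rmin b x)).
assert (Hc : forall x, a <= x <= b -> c x = x).
{ intros x Hx; unfold c; rewrite (Rmin_right b x), Rmax_right; lra. }
assert (Hca : forall x, x <= a -> c x = a).
{ intros x Hx; unfold c; rewrite (Rmin_right b x), Rmax_left; lra. }
assert (Hcb : forall x, b <= x -> c x = b).
{ intros x Hx; unfold c; rewrite (Rmin_left b x), Rmax_right; lra. }
exists (fun x => f (c x) + (x - c x) * f' (c x)).
intros s Hs; split; [rewrite (Hc s Hs); ring |].
split; [apply is_linear_scal_l |].
intros y Hy eps.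
apply (is_filter_lim_locally_unique (V := R_NormedModule) s y) in Hy; subst y.
destruct (Hf s Hs eps) as [delta Hdelta].
(* Within distance [r] of [s], a point can leave [[a, b]] only through an endpoint equal to [s]. The
   value 1 stands in for the zero distance when [s] is that endpoint. *)
assert (Hr : exists r : posreal, forall x, Rabs (x - s) < r ->
               (x < a -> s = a) /\ (b < x -> s = b)).
{ assert (Hpos : 0 < Rmin (if Req_EM_T s a then 1 else s - a)
                          (if Req_EM_T s b then 1 else b - s)).
  { apply Rmin_glb_lt; [destruct (Req_EM_T s a) | destruct (Req_EM_T s b)]; lra. }
  exists (mkposreal _ Hpos); intros x Hx; simpl in Hx.
  apply Rabs_def2 in Hx.
  pose proof (Rmin_l (if Req_EM_T s a then 1 else s - a)
                     (if Req_EM_T s b then 1 else b - s)).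
  pose proof (Rmin_r (if Req_EM_T s a then 1 else s - a)
                     (if Req_EM_T s b then 1 else b - s)).
  destruct (Req_EM_T s a); destruct (Req_EM_T s b); split; intros; lra. }
destruct Hr as [r Hr].
assert (Hm : 0 < Rmin delta r) by (apply Rmin_glb_lt; apply cond_pos).
exists (mkposreal _ Hm); intros x Hx.
change (Rabs (x - s) < Rmin delta r) in Hx.
change (Rabs ((f (c x) + (x - c x) * f' (c x)) - (f (c s) + (s - c s) * f' (c s))
              - (x - s) * f' s) <= eps * Rabs (x - s)).
pose proof (Rmin_l delta r); pose proof (Rmin_r delta r).
rewrite (Hc s Hs).
assert (Hnonneg : 0 <= eps * Rabs (x - s)).
{ apply Rmult_le_pos; [apply Rlt_le, cond_pos | apply Rabs_pos]. }
destruct (Hr x) as [Hra Hrb]; [lra |].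
destruct (Rlt_dec x a) as [Hxa | Hxa]; [| destruct (Rlt_dec b x) as [Hxb | Hxb]].
(* Beyond an endpoint the extension is exactly affine, so the error is 0. *)
- rewrite (Hca x) by lra; rewrite <- (Hra Hxa).
  match goal with |- Rabs ?e <= _ => replace e with 0 by ring end.
  now rewrite Rabs_R0.
- rewrite (Hcb x) by lra; rewrite <- (Hrb Hxb).
  match goal with |- Rabs ?e <= _ => replace e with 0 by ring end.
  now rewrite Rabs_R0.
- rewrite (Hc x) by lra.
  match goal with |- Rabs ?e <= _ =>
    replace e with (f x - f s - (x - s) * f' s) by ring end.
  apply Hdelta; lra.
Qed.

(** The mean value theorem gives [g b <= g x] for every [x] in the interval. Strictness comes from
    the first-order expansion at [a], which yields a point where [g] is already below [g a]. *)
Lemma is_derive_nonpos_lt (g dg : R -> R) (a b : R) :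
  a < b -> (forall s, a <= s <= b -> is_derive g s (dg s)) ->
  (forall s, a <= s <= b -> dg s <= 0) -> dg a < 0 -> g b < g a.
Proof.
intros Hab Hg Hle Ha.
assert (Hdec : forall x, a <= x <= b -> g b <= g x).
{ intros x Hx.
  destruct (MVT_gen g x b dg) as (xi & Hxi & E);
    rewrite ?Rmin_left, ?Rmax_right in * by lra.
  - intros s Hs; apply Hg; lra.
  - intros s Hs; apply continuity_pt_filterlim.
    apply (ex_derive_continuous (V := R_NormedModule) g s).
    exists (dg s); apply Hg; lra.
  - assert (dg xi * (b - x) <= 0 * (b - x)).
    { apply Rmult_le_compat_r; [| apply Hle]; lra. }
    lra. }
destruct (Hg a) as [_ Hd]; [lra |].
(* With this tolerance, [g (a + m) - g a <= m * dg a / 2 < 0]. *)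
assert (Heps : 0 < - dg a / 2) by lra.
destruct (Hd a (fun P HP => HP) (mkposreal _ Heps)) as [delta Hdelta].
pose proof (cond_pos delta).
set (m := Rmin (delta / 2) (b - a)).
assert (Hm : 0 < m) by (apply Rmin_glb_lt; lra).
assert (Hm1 : m <= delta / 2) by apply Rmin_l.
assert (Hm2 : m <= b - a) by apply Rmin_r.
assert (Hball : Rabs (a + m - a) < delta).
{ rewrite Rabs_pos_eq; lra. }
specialize (Hdelta (a + m) Hball).
change (Rabs (g (a + m) - g a - (a + m - a) * dg a)
        <= - dg a / 2 * Rabs (a + m - a)) in Hdelta.
replace (a + m - a) with m in Hdelta by ring.
rewrite (Rabs_pos_eq m) in Hdelta by lra.
apply Rabs_le_between in Hdelta.
assert (m * dg a < 0) by (apply Rmult_pos_neg; lra).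
specialize (Hdec (a + m)).
lra.
Qed.

(** * Rotations and unit vectors in coordinates *)

Lemma cis_0 : cis 0 = RtoC 1.
Proof. unfold cis; now rewrite cos_0, sin_0. Qed.

(** The velocity in the flow is known only as some derivative [v]; uniqueness of derivatives in each
    coordinate forces it to be the rotation field. *)
Lemma is_derive_rotation (B : R) (z v : C) :
  is_derive (K := R_AbsRing) (V := C_R_NormedModule)
    (fun t : R => (cis (B * t) * z)%C) 0 v ->
  v = (RtoC B * (Ci * z))%C.
Proof.
intros H.
assert (H1 : is_derive (fun t : R => cos (B * t) * Re z - sin (B * t) * Im z)
               0 (Re v)).
{ exact (filterdiff_comp _ (fst : C_R_NormedModule -> R_NormedModule) _ _
    H (filterdiff_linear _ is_linear_fst)). }
assert (H2 : is_derive (fun t : R => cos (B * t) * Im z + sin (B * t) * Re z)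
               0 (Im v)).
{ exact (filterdiff_comp _ (snd : C_R_NormedModule -> R_NormedModule) _ _
    H (filterdiff_linear _ is_linear_snd)). }
assert (K1 : is_derive (fun t : R => cos (B * t) * Re z - sin (B * t) * Im z)
               0 (- B * Im z)).
{ auto_derive; [exact I |]. rewrite Rmult_0_r, cos_0, sin_0; ring. }
assert (K2 : is_derive (fun t : R => cos (B * t) * Im z + sin (B * t) * Re z)
               0 (B * Re z)).
{ auto_derive; [exact I |]. rewrite Rmult_0_r, cos_0, sin_0; ring. }
apply is_derive_unique in H1, H2, K1, K2.
apply injective_projections; simpl; unfold Re, Im in *; lra.
Qed.

Lemma Cmod_eq_1 (z : C) : Cmod z = 1 -> Re z * Re z + Im z * Im z = 1.
Proof.
intros H.
replace 1 with (Cmod z * Cmod z) by (rewrite H; ring).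
unfold Cmod; rewrite sqrt_sqrt; [unfold Re, Im; ring |].
pose proof (pow2_ge_0 (fst z)); pose proof (pow2_ge_0 (snd z)); lra.
Qed.

(** Multiplication by [i] is skew, so this is minus the support function [<z, i T>]: orthogonality
    to the circle says that the support function vanishes. *)
Lemma inner_Ci (T z : C) : inner T (Ci * z)%C = Re z * Im T - Im z * Re T.
Proof. unfold inner, Re, Im; simpl; ring. Qed.

Lemma unit_tangent_unit (gamma' : R -> C) (s : R) :
  Cmod (gamma' s) = 1 -> unit_tangent gamma' s = gamma' s.
Proof.
intros H; unfold unit_tangent; rewrite H.
field; apply RtoC_neq; lra.
Qed.

(** * Monotonicity of the support function *)

Theorem theorem1p2 :
  ~ exists (B L : R) (gamma0 : R -> C),
      0 < B /\ 0 < L /\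
      smooth_curve (- (L / 2)) (L / 2) gamma0 /\
      unit_speed (- (L / 2)) (L / 2) gamma0 /\
      proper_in_disc (- (L / 2)) (L / 2) gamma0 /\
      meets_circle_orthogonally (- (L / 2)) (L / 2) gamma0 /\
      free_boundary_csf (- (L / 2)) (L / 2)
        (fun t s : R => (cis (B * t) * gamma0 s)%C).
Proof.
intros (B & L & gamma & HB & HL & _ & (T & HT & HT1) & (_ & Ha1 & _)
        & (T2 & HT2 & Hoa & Hob) & (_ & _ & _ & Hcsf)).
(* At time 0 the rotation is the identity, so the evolving curve is [gamma] itself. *)
destruct (Hcsf 0) as (Fs & Ft & k & HFs & _ & HFt & (T' & HT' & Hk) & Hn).
revert HT HT1 Ha1 HT2 Hoa Hob HFs HFt HT' Hk Hn.
assert (Hab : - (L / 2) < L / 2) by lra.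
revert Hab; generalize (- (L / 2)); generalize (L / 2); clear L HL Hcsf.
intros b a Hab HT HT1 Ha1 HT2 Hoa Hob HFs HFt HT' Hk Hn.
assert (E2 : forall s, a <= s <= b -> T2 s = T s)
  by (apply (is_derivative_on_unique _ _ gamma); assumption).
rewrite E2, inner_Ci in Hoa by lra; rewrite E2, inner_Ci in Hob by lra.
assert (EF : forall s, a <= s <= b -> Fs s = T s).
{ apply (is_derivative_on_unique _ _ gamma); [assumption | | assumption].
  intros s Hs; specialize (HFs s Hs).
  eapply (filterdiff_ext (V := C_R_NormedModule)); [| exact HFs].
  intros y; cbv beta; rewrite Rmult_0_r, cis_0; apply Cmult_1_l. }
assert (ET : forall s, a <= s <= b -> unit_tangent Fs s = T s).
{ intros s Hs; rewrite unit_tangent_unit; rewrite (EF s Hs); auto. }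
(* The flow equation: at unit speed the curvature vector is [T'], and the rotation moves [gamma]
   with velocity [B i gamma]. *)
assert (Ecurv : forall s, a <= s <= b ->
          T' s = normal_component (T s) (RtoC B * (Ci * gamma s))%C).
{ intros s Hs.
  rewrite <- (is_derive_rotation _ _ _ (HFt s Hs)), <- (ET s Hs), (Hn s Hs),
    (Hk s Hs), (EF s Hs), (HT1 s Hs).
  field; apply RtoC_neq; lra. }
(* Two-sided extensions of the coordinates, [(x, y)] for [gamma] and [(u, v)] for [T]. *)
destruct (is_real_derivative_on_extend a b _ _ Hab
            (is_derivative_on_Re _ _ _ _ HT)) as [x Hx].
destruct (is_real_derivative_on_extend a b _ _ Hab
            (is_derivative_on_Im _ _ _ _ HT)) as [y Hy].
destruct (is_real_derivative_on_extend a b (fun s => Re (T s))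
            (fun s => Re (T' s)) Hab) as [u Hu].
{ eapply is_real_derivative_on_ext; [| | exact (is_derivative_on_Re _ _ _ _ HT')];
    intros s Hs; cbv beta; [now rewrite ET | reflexivity]. }
destruct (is_real_derivative_on_extend a b (fun s => Im (T s))
            (fun s => Im (T' s)) Hab) as [v Hv].
{ eapply is_real_derivative_on_ext; [| | exact (is_derivative_on_Im _ _ _ _ HT')];
    intros s Hs; cbv beta; [now rewrite ET | reflexivity]. }
(* With [N = (- v, u)], the function [y u - x v] is [<gamma, N>]. *)
assert (Hg : forall s, a <= s <= b ->
          is_derive (fun s => y s * u s - x s * v s) s
            (- B * (x s * u s + y s * v s) ^ 2)).
{ intros s Hs.
  destruct (Hx s Hs) as [Ex Dx]; destruct (Hy s Hs) as [Ey Dy].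
  destruct (Hu s Hs) as [Eu Du]; destruct (Hv s Hs) as [Ev Dv].
  pose proof (Cmod_eq_1 _ (HT1 s Hs)) as H1.
  rewrite <- Eu, <- Ev in H1.
  assert (Eu' : Re (T' s) = - B * y s - B * (x s * v s - y s * u s) * u s).
  { rewrite (Ecurv s Hs), Ex, Ey, Eu, Ev.
    unfold normal_component, inner, Re, Im; simpl; ring. }
  assert (Ev' : Im (T' s) = B * x s - B * (x s * v s - y s * u s) * v s).
  { rewrite (Ecurv s Hs), Ex, Ey, Eu, Ev.
    unfold normal_component, inner, Re, Im; simpl; ring. }
  (* Since [x' = u] and [y' = v], the terms [y' u - x' v] cancel and only [y u' - x v'] remains. *)
  rewrite Eu' in Du; rewrite Ev' in Dv; rewrite <- Eu in Dx; rewrite <- Ev in Dy.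
  auto_derive.
  - repeat split; eexists; eassumption.
  - rewrite (is_derive_unique (fun r : R => x r) s _ Dx),
      (is_derive_unique (fun r : R => y r) s _ Dy),
      (is_derive_unique (fun r : R => u r) s _ Du),
      (is_derive_unique (fun r : R => v r) s _ Dv).
    (* [<gamma, T>^2 = |gamma|^2 |T|^2 - <gamma, i T>^2] with [|T| = 1] *)
    replace ((x s * u s + y s * v s) ^ 2) with
      ((x s ^ 2 + y s ^ 2) * (u s * u s + v s * v s)
       - (x s * v s - y s * u s) ^ 2) by ring.
    rewrite H1; ring. }
destruct (Hx a) as [Exa _]; [lra |]; destruct (Hy a) as [Eya _]; [lra |].
destruct (Hu a) as [Eua _]; [lra |]; destruct (Hv a) as [Eva _]; [lra |].
destruct (Hx b) as [Exb _]; [lra |]; destruct (Hy b) as [Eyb _]; [lra |].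
destruct (Hu b) as [Eub _]; [lra |]; destruct (Hv b) as [Evb _]; [lra |].
apply Cmod_eq_1 in Ha1.
assert (HTa : Re (T a) * Re (T a) + Im (T a) * Im (T a) = 1)
  by (apply Cmod_eq_1, HT1; lra).
rewrite <- Exa, <- Eya in Ha1; rewrite <- Eua, <- Eva in HTa.
rewrite <- Exa, <- Eya, <- Eua, <- Eva in Hoa.
rewrite <- Exb, <- Eyb, <- Eub, <- Evb in Hob.
assert (Hlt := is_derive_nonpos_lt _ _ a b Hab Hg).
cbv beta in Hlt.
(* Both sides are 0 by [Hoa] and [Hob], so strict decrease is absurd. *)
enough (y b * u b - x b * v b < y a * u a - x a * v a) by lra.
apply Hlt.
- intros s _.
  assert (0 <= B * (x s * u s + y s * v s) ^ 2).
  { apply Rmult_le_pos; [lra | apply pow2_ge_0]. }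
  lra.
(* The same identity at [a], where both vectors are unit and [<gamma, N> = 0], turns the derivative
   into [- B]. *)
- replace ((x a * u a + y a * v a) ^ 2) with
    ((x a * x a + y a * y a) * (u a * u a + v a * v a)
     - (x a * v a - y a * u a) ^ 2) by ring.
  rewrite Ha1, HTa, Hoa; lra.
Qed.
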